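(* For a Lowen fuzzy topological space $X$, the following are equivalent: (i) $X$ is exponentiable in $\mathbf{LFTS}$; (ii) the evaluation map $e:(\tau_X,\Sigma_X)\times X\to\mathbb{S}$, $e(\mu,x)=\mu(x)$, is continuous; (iii) $X$ satisfies stratified Scott–core approximation (SKA), i.e. for every $\mu\in\tau_X$, $$\mu=\bigvee_{\substack{\Phi\in\Sigma_X,\ \lambda\in\tau_X\\ \lambda\triangleleft\Phi}}\bigl(\underline{\Phi(\mu)}\wedge\lambda\bigr).$$ When these conditions hold, for every Lowen fuzzy topological space $Y$ the exponential $Y^X$ has underlying set $C(X,Y)$, with the Lowen topology generated by the constants and the maps $$[\Phi,v]:C(X,Y)\to\mathbb{I},\qquad [\Phi,v](f)=\Phi(v\circ f),\qquad \Phi\in\Sigma_X,\ v\in\tau_Y.$$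
   Context: Let $\mathbb{I}=[0,1]$ with its usual order; $\underline{a}$ denotes the constant map with value $a\in\mathbb{I}$; joins $\bigvee$ and meets $\wedge$ of $\mathbb{I}$-valued maps, and the order $\le$, are pointwise. A (stratified) Lowen fuzzy topology on a set $X$ is a subset $\tau_X\subseteq\mathbb{I}^X$ containing all constant maps and closed under arbitrary pointwise joins and finite pointwise meets; $(X,\tau_X)$ is a Lowen (fuzzy topological) space and members of $\tau_X$ are called fuzzy open. The topology generated by a family is the least Lowen topology containing it. A map $f:X\to Y$ is continuous if $v\circ f\in\tau_X$ for all $v\in\tau_Y$. $\mathbf{LFTS}$ is the category of Lowen spaces and continuous maps; $C(X,Y)$ is the set of continuous maps $X\to Y$. The product $Z\times X$ carries the Lowen topology generated by $a\circ\mathrm{pr}_Z$ ($a\in\tau_Z$) and $b\circ\mathrm{pr}_X$ ($b\in\tau_X$); similarly for finite products. $X$ is exponentiable in $\mathbf{LFTS}$ if the functor $-\times X:\mathbf{LFTS}\to\mathbf{LFTS}$ has a right adjoint, written $Y\mapsto Y^X$; with underlying set $C(X,Y)$, the adjunction is given by transposition $H\mapsto\widehat H$, $\widehat H(z)=H(z,\cdot)$, with counit the evaluation $(f,x)\mapsto f(x)$. $\mathbb{S}=(\mathbb{I},\delta_{\mathbb{S}})$, where $\delta_{\mathbb{S}}$ is the least Lowen topology on $\mathbb{I}$ containing $\mathrm{id}_{\mathbb{I}}$. Regard $\tau_X$ as a complete lattice in the pointwise order; directed sets are nonempty. A map $\Phi:\tau_X\to\mathbb{I}$ is Scott-continuous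 if it is monotone and $\Phi(\bigvee D)=\bigvee_{\mu\in D}\Phi(\mu)$ for every directed $D\subseteq\tau_X$. It satisfies finite-tier compatibility (FTC) if for every $n\ge1$ and $\beta_1,\dots,\beta_n\in\tau_X$ the map $\mathbb{I}^n\to\mathbb{I}$, $(r_1,\dots,r_n)\mapsto\Phi\bigl(\bigvee_{i=1}^n(\underline{r_i}\wedge\beta_i)\bigr)$ is fuzzy open in the product $\mathbb{S}^n$. $\Sigma_X$ is the set of all Scott-continuous $\Phi:\tau_X\to\mathbb{I}$ satisfying FTC; it is a Lowen fuzzy topology on the set $\tau_X$. For $\lambda\in\tau_X$ and $\Phi\in\Sigma_X$, $\lambda\triangleleft\Phi$ means $\underline{\Phi(\nu)}\wedge\lambda\le\nu$ for all $\nu\in\tau_X$. *)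

(* Defs.v *)
From mathcomp Require Import all_boot all_order all_algebra.
From mathcomp Require Import all_classical all_reals interval_inference.

Set Implicit Arguments.
Unset Strict Implicit.
Unset Printing Implicit Defensive.

Import Order.TTheory GRing.Theory Num.Theory.
Local Open Scope classical_set_scope.
Local Open Scope ring_scope.

Record category := Category {
  obj :> Type;
  cathom : obj -> obj -> Type;
  catid : forall A, cathom A A;
  catcomp : forall A B C, cathom B C -> cathom A B -> cathom A C;
  comp1c : forall A B (f : cathom A B), catcomp (catid B) f = f;
  compc1 : forall A B (f : cathom A B), catcomp f (catid A) = f;
  compcA : forall A B C D (h : cathom C D) (g : cathom B C) (f : cathom A B),
    catcomp h (catcomp g f) = catcomp (catcomp h g) f }.

Arguments cathom {c} A B.
Arguments catid {c} A.
Arguments catcomp {c A B C} g f.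

Definition is_iso (C : category) (A B : C) (f : cathom A B) : Prop :=
  exists g : cathom B A, catcomp g f = catid A /\ catcomp f g = catid B.

Record cfunctor (C D : category) := CFunctor {
  fobj :> C -> D;
  fmap : forall A B : C, cathom A B -> cathom (fobj A) (fobj B);
  fmap1 : forall A : C, fmap (catid A) = catid (fobj A);
  fmap_comp : forall (A B E : C) (g : cathom B E) (f : cathom A B),
    fmap (catcomp g f) = catcomp (fmap g) (fmap f) }.

Arguments fmap {C D} F {A B} f : rename.

(** [adjunction F G]: [F] is left adjoint to [G]. *)
Record adjunction (C D : category) (F : cfunctor C D) (G : cfunctor D C) :=
  Adjunction {
    transpose : forall (A : C) (B : D), cathom (F A) B -> cathom A (G B);
    untranspose : forall (A : C) (B : D), cathom A (G B) -> cathom (F A) B;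
    transposeK : forall A B, cancel (@transpose A B) (@untranspose A B);
    untransposeK : forall A B, cancel (@untranspose A B) (@transpose A B);
    transpose_natl : forall (A A' : C) (B : D) (h : cathom (F A) B) (f : cathom A' A),
      transpose (catcomp h (fmap F f)) = catcomp (transpose h) f;
    transpose_natr : forall (A : C) (B B' : D) (g : cathom B B') (h : cathom (F A) B),
      transpose (catcomp g h) = catcomp (fmap G g) (transpose h) }.

Arguments transpose {C D F G} adj {A B} h : rename.
Arguments untranspose {C D F G} adj {A B} k : rename.

Definition counit (C D : category) (F : cfunctor C D) (G : cfunctor D C)
    (adj : adjunction F G) (B : D) : cathom (F (G B)) B :=
  untranspose adj (catid (G B)).

Definition has_right_adjoint (C D : category) (F : cfunctor C D) : Prop :=
  exists G : cfunctor D C, inhabited (adjunction F G).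

Section UnitInterval.
Variable R : realType.
Implicit Types (A B : set {i01 R}) (a b : {i01 R}).

(** [supremum] returns its first argument on the empty set. *)
Definition isup A : {i01 R} := supremum (0%:i01 : {i01 R}) A.

Lemma i01_ge0 a : (0%:i01 : {i01 R}) <= a.
Proof. exact: (ge0 a). Qed.

Lemma isup_supremums A : supremums A (isup A).
Proof.
rewrite /isup /supremum; case: ifPn => [/eqP->|/set0P A0].
  by split=> [b []|b _]; exact: i01_ge0.
suff [s sA] : supremums A !=set0 by exact: (xgetI _ sA).
pose B := [set a%:num | a in A].
have supB : has_sup B.
  case: A0 => a Aa; split; first by exists a%:num, a.
  by exists 1 => _ [b _ <-]; exact: le1.
have B0 : 0 <= sup B.
  have [a Aa] := A0.
  have : a%:num <= sup B by apply: ub_le_sup; [case: supB|exists a].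
  by apply: le_trans; exact: ge0.
have B1 : sup B <= 1.
  by apply: ge_sup; [case: supB|move=> _ [b _ <-]; exact: le1].
exists (Itv01 B0 B1); split.
  move=> a Aa; change (a%:num <= sup B).
  by apply: ub_le_sup; [case: supB|exists a].
move=> b Ab; change (sup B <= b%:num).
by apply: ge_sup; [case: supB|move=> _ [a Aa <-]; exact: (Ab a)].
Qed.

Lemma isup_ub A a : A a -> a <= isup A.
Proof. by case: (isup_supremums A) => + _; apply. Qed.

Lemma isup_le A b : (forall a, A a -> a <= b) -> isup A <= b.
Proof. by case: (isup_supremums A) => _; apply. Qed.

Lemma isup_gt A a : a < isup A -> exists2 b, A b & a < b.
Proof.
move=> aA; apply: contrapT => nA.
suff : isup A <= a by rewrite leNgt aA.
by apply: isup_le => b Ab; rewrite leNgt; apply/negP => ab; apply: nA; exists b.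
Qed.

Section Maps.
Variable X : Type.

Definition jmap (F : set (X -> {i01 R})) : X -> {i01 R} :=
  fun x => isup [set f x | f in F].
Definition mmap (f g : X -> {i01 R}) : X -> {i01 R} :=
  fun x => Num.min (f x) (g x).

Lemma jmap_image (J : Type) (D : set J) (h : J -> X -> {i01 R}) :
  jmap [set h j | j in D] = fun x => isup [set h j x | j in D].
Proof.
apply: funext => x; congr isup; rewrite predeqE => a; split.
  by case=> _ [j Dj <-] <-; exists j.
by case=> j Dj <-; exists (h j) => //; exists j.
Qed.

End Maps.
End UnitInterval.

(** The empty meet is a constant map, so closure under binary meets gives
    closure under all finite meets. *)
Definition lowen_topology (R : realType) (X : Type)
    (T : set (X -> {i01 R})) : Prop :=
  [/\ forall a : {i01 R}, T (cst a),
      forall F : set (X -> {i01 R}), F `<=` T -> T (jmap F) &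
      forall f g, T f -> T g -> T (mmap f g)].

Definition lowen_gen (R : realType) (X : Type) (G : set (X -> {i01 R})) :
  set (X -> {i01 R}) := smallest (@lowen_topology R X) G.

Lemma lowen_genP (R : realType) (X : Type) (G : set (X -> {i01 R})) :
  lowen_topology (lowen_gen G).
Proof.
split=> [a T [[Tc _ _] _]|F FG T [TT GT]|f g Gf Gg T [TT GT]].
- exact: Tc.
- by case: (TT) => _ + _; apply => f /FG; apply.
- by case: (TT) => _ _; apply; [exact: Gf|exact: Gg].
Qed.

Lemma lowen_gen_sub (R : realType) (X : Type) (G : set (X -> {i01 R})) :
  G `<=` lowen_gen G.
Proof. by move=> g Gg T [_]; apply. Qed.

Record lowen (R : realType) := Lowen {
  lcarrier :> Type;
  lopen : set (lcarrier -> {i01 R});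
  lopenP : lowen_topology lopen }.

Arguments lopen {R} X f : rename.

Definition lcontinuous (R : realType) (X Y : lowen R) (f : X -> Y) : Prop :=
  forall v, lopen Y v -> lopen X (v \o f).

Record lmap (R : realType) (X Y : lowen R) := LMap {
  lmap_fun :> X -> Y;
  lmapP : lcontinuous lmap_fun }.

Lemma lmap_eq (R : realType) (X Y : lowen R) (f g : lmap X Y) :
  (forall x, f x = g x) -> f = g.
Proof.
case: f g => [f fP] [g gP] /= /funext fg; case: _ / fg gP => gP.
by congr LMap; exact: Prop_irrelevance.
Qed.

Lemma lcontinuous_gen (R : realType) (X : lowen R) (Y : Type)
    (G : set (Y -> {i01 R})) (f : X -> Y) :
  (forall g, G g -> lopen X (g \o f)) ->
  @lcontinuous R X (Lowen (lowen_genP G)) f.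
Proof.
move=> fG v /= Gv; have [Xc Xj Xm] := lopenP X.
suff PG : [set u : Y -> {i01 R} | lopen X (u \o f)] v by [].
apply: Gv; split => //; split=> /=.
- by move=> a; exact: Xc.
- move=> F FX; suff -> : jmap F \o f = jmap [set u \o f | u in F].
    by apply: Xj => _ [u /FX ? <-].
  by rewrite jmap_image.
- by move=> u w Xu Xw; exact: Xm.
Qed.

Lemma lcontinuous_id (R : realType) (X : lowen R) : lcontinuous (@id X).
Proof. by []. Qed.

Lemma lcontinuous_comp (R : realType) (X Y Z : lowen R) (g : lmap Y Z)
  (f : lmap X Y) : lcontinuous (g \o f).
Proof. by move=> v /(lmapP g) /(lmapP f). Qed.

Definition lid (R : realType) (X : lowen R) : lmap X X :=
  LMap (@lcontinuous_id R X).
Definition lcomp (R : realType) (X Y Z : lowen R) (g : lmap Y Z)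
  (f : lmap X Y) : lmap X Z := LMap (lcontinuous_comp g f).

Definition LFTS (R : realType) : category.
Proof.
refine (@Category (lowen R) (@lmap R) (@lid R) (@lcomp R) _ _ _);
  by intros; apply: lmap_eq.
Defined.

Definition prod_gen (R : realType) (Z X : lowen R) : set (Z * X -> {i01 R}) :=
  [set a \o fst | a in lopen Z] `|` [set b \o snd | b in lopen X].

Definition lprod (R : realType) (Z X : lowen R) : lowen R :=
  Lowen (lowen_genP (@prod_gen R Z X)).

Definition lpow (R : realType) (n : nat) (X : lowen R) : lowen R :=
  Lowen (lowen_genP
    [set h : ('I_n -> X) -> {i01 R} |
      exists i a, lopen X a /\ h = fun r => a (r i)]).

Lemma lprod_mapP (R : realType) (X Z Z' : lowen R) (f : lmap Z Z') :
  @lcontinuous R (lprod Z X) (lprod Z' X) (fun p => (f p.1, p.2)).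
Proof.
apply: lcontinuous_gen => g [[a Za <-]|[b Xb <-]];
  apply: lowen_gen_sub; [left|right].
  by exists (a \o f) => //; exact: lmapP.
by exists b.
Qed.

Definition prod_functor (R : realType) (X : lowen R) :
  cfunctor (LFTS R) (LFTS R).
Proof.
refine (@CFunctor (LFTS R) (LFTS R) (fun Z : lowen R => lprod Z X)
  (fun Z Z' (f : lmap Z Z') => LMap (@lprod_mapP R X Z Z' f)) _ _);
  by intros; apply: lmap_eq; case.
Defined.

Definition exponentiable (R : realType) (X : lowen R) : Prop :=
  has_right_adjoint (prod_functor X).

Definition lS (R : realType) : lowen R :=
  Lowen (lowen_genP [set (@id {i01 R})]).

Record fopen (R : realType) (X : lowen R) := FOpen {
  fopen_fun :> X -> {i01 R};
  fopenP : lopen X fopen_fun }.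

Section FOpen.
Variables (R : realType) (X : lowen R).
Implicit Types (mu nu lam : fopen X) (D : set (fopen X)) (a : {i01 R}).

Lemma fopen_eq mu nu : (forall x, mu x = nu x) -> mu = nu.
Proof.
case: mu nu => [f fP] [g gP] /= /funext fg; case: _ / fg gP => gP.
by congr FOpen; exact: Prop_irrelevance.
Qed.

Definition fle mu nu : Prop := forall x, mu x <= nu x.

Lemma fcst_subproof a : lopen X (cst a).
Proof. by case: (lopenP X). Qed.
Definition fcst a : fopen X := FOpen (fcst_subproof a).

Lemma fmeet_subproof mu nu : lopen X (mmap mu nu).
Proof. by case: (lopenP X) => _ _; apply; exact: fopenP. Qed.
Definition fmeet mu nu : fopen X := FOpen (fmeet_subproof mu nu).

Lemma fjoin_subproof D : lopen X (jmap [set (mu : X -> {i01 R}) | mu in D]).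
Proof. by case: (lopenP X) => _ + _; apply => _ [mu _ <-]; exact: fopenP. Qed.
Definition fjoin D : fopen X := FOpen (fjoin_subproof D).

Definition fdirected D : Prop :=
  D !=set0 /\
  forall mu nu, D mu -> D nu -> exists lam, [/\ D lam, fle mu lam & fle nu lam].

Implicit Types Phi : fopen X -> {i01 R}.

Definition scott_continuous Phi : Prop :=
  (forall mu nu, fle mu nu -> Phi mu <= Phi nu) /\
  (forall D, fdirected D -> Phi (fjoin D) = isup [set Phi mu | mu in D]).

Definition FTC Phi : Prop :=
  forall (n : nat) (beta : 'I_n -> fopen X), (1 <= n)%N ->
    lopen (lpow n (lS R))
      (fun r => Phi (fjoin [set fmeet (fcst (r i)) (beta i) | i in [set: 'I_n]])).

Definition Sigma : set (fopen X -> {i01 R}) :=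
  [set Phi | scott_continuous Phi /\ FTC Phi].

Lemma Sigma_lowen : lowen_topology Sigma.
Proof.
split.
- move=> a; split; last first.
    by move=> n beta _; case: (lopenP (lpow n (lS R))) => + _ _; apply.
  split=> [mu nu _|D [[mu Dmu] _]]; first by rewrite /cst.
  apply/eqP; rewrite eq_le /cst; apply/andP; split.
    by apply: isup_ub; exists mu.
  by apply: isup_le => _ [nu _ <-].
- move=> F FS; split; last first.
    move=> n beta n0; case: (lopenP (lpow n (lS R))) => _ + _.
    move=> /(_ [set (fun r : lpow n (lS R) => Phi (fjoin
      [set fmeet (fcst (r i)) (beta i) | i in [set: 'I_n]])) | Phi in F]).
    rewrite jmap_image; apply => _ [Phi /FS[_ ftc] <-]; exact: ftc.
  split=> [mu nu munu|D dD].
    apply: isup_le => _ [Phi FPhi <-]; have [[mon _] _] := FS _ FPhi.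
    by apply: le_trans (mon _ _ munu) _; apply: isup_ub; exists Phi.
  apply/eqP; rewrite eq_le; apply/andP; split.
    apply: isup_le => _ [Phi FPhi <-]; have [[_ ->//] _] := FS _ FPhi.
    apply: isup_le => _ [mu Dmu <-].
    apply: (@le_trans _ _ (jmap F mu)); last by apply: isup_ub; exists mu.
    by apply: isup_ub; exists Phi.
  apply: isup_le => _ [mu Dmu <-]; apply: isup_le => _ [Phi FPhi <-].
  apply: (@le_trans _ _ (Phi (fjoin D))); last by apply: isup_ub; exists Phi.
  have [[_ ->//] _] := FS _ FPhi.
  by apply: isup_ub; exists mu.
- move=> Phi Psi [[monPhi joinPhi] ftcPhi] [[monPsi joinPsi] ftcPsi].
  split; last first.
    move=> n beta n0; case: (lopenP (lpow n (lS R))) => _ _; apply.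
    + exact: ftcPhi.
    + exact: ftcPsi.
  have mon mu nu : fle mu nu -> mmap Phi Psi mu <= mmap Phi Psi nu.
    move=> le; rewrite /mmap le_min !ge_min monPhi//= monPsi//.
    by rewrite orbT.
  split=> // D dD; apply/eqP; rewrite eq_le; apply/andP; split; last first.
    apply: isup_le => _ [mu Dmu <-]; apply: mon => x.
    by apply: isup_ub; exists (mu : X -> {i01 R}) => //; exists mu.
  rewrite leNgt; apply/negP; rewrite [X in _ < X]/mmap lt_min.
  rewrite joinPhi// joinPsi//.
  move=> /andP[/isup_gt[_ [mu Dmu <-] ltmu] /isup_gt[_ [nu Dnu <-] ltnu]].
  have [_ /(_ _ _ Dmu Dnu)[lam [Dlam mulam nulam]]] := dD.
  have : mmap Phi Psi lam <= isup [set mmap Phi Psi x | x in D].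
    by apply: isup_ub; exists lam.
  rewrite leNgt /mmap lt_min (lt_le_trans ltmu) ?monPhi//=.
  by rewrite (lt_le_trans ltnu)// monPsi.
Qed.

Definition Sigma_space : lowen R := Lowen Sigma_lowen.

Definition feval : lprod Sigma_space X -> lS R := fun p => (p.1 : fopen X) p.2.

(** [lam ◁ Phi] *)
Definition ltri lam Phi : Prop :=
  forall nu, fle (fmeet (fcst (Phi nu)) lam) nu.

Definition SKA : Prop :=
  forall mu : fopen X,
    mu = fjoin [set nu | exists Phi lam,
      [/\ Sigma Phi, ltri lam Phi & nu = fmeet (fcst (Phi mu)) lam]].

End FOpen.

Definition fpull (R : realType) (X Y : lowen R) (v : fopen Y) (f : lmap X Y) :
  fopen X := FOpen (lmapP f (fopenP v)).

Definition exp_gen (R : realType) (X Y : lowen R) : set (lmap X Y -> {i01 R}) :=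
  [set cst a | a in [set: {i01 R}]] `|`
  [set h | exists Phi v, @Sigma R X Phi /\ h = fun f => Phi (@fpull R X Y v f)].

Definition lexp (R : realType) (X Y : lowen R) : lowen R :=
  Lowen (lowen_genP (@exp_gen R X Y)).

Lemma lexp_mapP (R : realType) (X Y Y' : lowen R) (g : lmap Y Y') :
  @lcontinuous R (lexp X Y) (lexp X Y') (lcomp g).
Proof.
apply: lcontinuous_gen => h [[a _ <-]|[Phi [v [SPhi ->]]]];
  apply: lowen_gen_sub; [left|right]; first by exists a.
exists Phi, (fpull v g); split=> //; apply: funext => f /=.
by congr Phi; apply: fopen_eq.
Qed.

(** [Y ↦ lexp X Y] is always a functor, acting on maps by postcomposition;
    whether it is right adjoint to [- × X] depends on [X]. *)
Definition exp_functor (R : realType) (X : lowen R) :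
  cfunctor (LFTS R) (LFTS R).
Proof.
refine (@CFunctor (LFTS R) (LFTS R) (lexp X)
  (fun Y Y' (g : lmap Y Y') => LMap (@lexp_mapP R X Y Y' g)) _ _);
  by intros; apply: lmap_eq => h; apply: lmap_eq.
Defined.

(* Main.v *)
Require Import Defs.
From mathcomp Require Import all_boot all_order all_algebra.
From mathcomp Require Import all_classical all_reals interval_inference.

Set Implicit Arguments.
Unset Strict Implicit.
Unset Printing Implicit Defensive.

Import Defs.
Import Order.TTheory GRing.Theory Num.Theory.
Local Open Scope classical_set_scope.
Local Open Scope ring_scope.

(** The whole theorem rests on a description of [Sigma] by test spaces.  Call a
    family [h : Z -> fopen X] jointly open when [(z, x) |-> h z x] is open in
    [Z * X]; these are the transposes of the continuous maps from [Z * X] to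
    [lS R].  Then [Phi] lies in [Sigma] exactly when [Phi \o h] is open for
    every jointly open [h] ([SigmaP]).

    For one direction, an open map of [Z * X] is a supremum of open rectangles
    [a(z) /\ b(x)] ([lopen_prodP]), so [h z] is a directed join of finite
    combinations [\/_i (A_i(z) /\ beta_i)].  Scott continuity moves [Phi] inside
    the directed join, and FTC makes each [Phi (\/_i (A_i(z) /\ beta_i))] open
    in [z].  For the other direction, FTC is the condition for the jointly open
    family [r |-> \/_i (r_i /\ beta_i)] on a power of [lS R], and Scott
    continuity at a directed set [D] is read off a test space whose open maps
    are the monotone maps that preserve the join of [D].

    Given this, each implication is short.

    - Continuity of the evaluation [feval] says that it is a supremum of open
      rectangles [Phi(mu) /\ lam(x)] below it, and such a rectangle lies below
      [feval] exactly when [ltri lam Phi]; this is SKA ([feval_SKA]).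

    - The transpose of a continuous map is continuous into [lexp X Y] for every
      [X], by [SigmaP].  SKA makes [lexp X Y * X -> Y] continuous: pulling an
      open [v] back along it gives [(f, x) |-> feval (v \o f, x)].  So SKA makes
      [exp_functor X] a right adjoint ([exp_adjunction]).

    - For an arbitrary right adjoint [G], every open map of [G (lS R)], read as
      a map on [fopen X], satisfies the test-space condition, because transposes
      of jointly open families are continuous.  Hence it belongs to [Sigma]:
      the space of opens with topology [Sigma] maps continuously to [G (lS R)],
      and [feval] is the counit composed with that map ([adjunction_feval]).

    Right adjoints being unique up to isomorphism, every exponential is
    [lexp X Y], compatibly with evaluation. *)

(** * Uniqueness of right adjoints *)

Section Adjunctions.
Variables (C D : category) (F : cfunctor C D).

Lemma untranspose_natl (G : cfunctor D C) (adj : adjunction F G) (A A' : C)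
    (B : D) (k : cathom A (G B)) (f : cathom A' A) :
  untranspose adj (catcomp k f) = catcomp (untranspose adj k) (fmap F f).
Proof.
rewrite -[RHS](transposeK adj); congr untranspose.
by rewrite transpose_natl untransposeK.
Qed.

Lemma untransposeE (G : cfunctor D C) (adj : adjunction F G) (A : C) (B : D)
    (k : cathom A (G B)) :
  untranspose adj k = catcomp (counit adj B) (fmap F k).
Proof. by rewrite /counit -untranspose_natl comp1c. Qed.

Lemma counit_transpose (G : cfunctor D C) (adj : adjunction F G) (A : C)
    (B : D) (h : cathom (F A) B) :
  catcomp (counit adj B) (fmap F (transpose adj h)) = h.
Proof. by rewrite -untransposeE transposeK. Qed.

(** The two comparison maps between right adjoints are mutually inverse: both
    sides become the counit of [adj] once untransposed, and untransposing is
    injective. *)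
Lemma transpose_counitK (G G' : cfunctor D C) (adj : adjunction F G)
    (adj' : adjunction F G') (B : D) :
  catcomp (transpose adj (counit adj' B)) (transpose adj' (counit adj B))
  = catid (G B).
Proof.
apply: (can_inj (@untransposeK _ _ _ _ adj (G B) B)).
by rewrite untranspose_natl transposeK counit_transpose.
Qed.

Lemma right_adjoint_iso (G G' : cfunctor D C) (adj : adjunction F G)
    (adj' : adjunction F G') (B : D) :
  is_iso (transpose adj' (counit adj B)).
Proof.
by exists (transpose adj (counit adj' B)); split; exact: transpose_counitK.
Qed.

End Adjunctions.

(** * Open maps of products, powers and the Sierpinski space *)

Section LowenSpaces.
Variable R : realType.
Implicit Types X Y Z : lowen R.

Lemma i01_le1 (a : {i01 R}) : a <= (1%:i01 : {i01 R}).
Proof. exact: (le1 a). Qed.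

(** Such a map is the pointwise join of the open maps below it. *)
Lemma lopen_local Z (w : Z -> {i01 R}) :
  (forall z c, c < w z ->
     exists g, [/\ lopen Z g, forall z', g z' <= w z' & c < g z]) ->
  lopen Z w.
Proof.
move=> wloc; have [_ Zj _] := lopenP Z.
suff -> : w = jmap [set g | lopen Z g /\ forall z, g z <= w z].
  by apply: Zj => g [].
apply: funext => z; apply/eqP; rewrite eq_le; apply/andP; split.
  rewrite leNgt; apply/negP => /wloc[g [Zg gw]].
  by apply/negP; rewrite -leNgt; apply: isup_ub; exists g.
by apply: isup_le => _ [g [_ gw] <-].
Qed.

(** The suprema of open rectangles form a Lowen topology containing the
    generators; binary meets stay in it because meets of the chain distribute
    over joins and the meet of two rectangles is a rectangle. *)
Lemma lopen_prodP Z X (w : Z * X -> {i01 R}) :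
  lopen (lprod Z X) w <->
  forall p c, c < w p -> exists a b, [/\ lopen Z a, lopen X b,
    forall q, Num.min (a q.1) (b q.2) <= w q & c < Num.min (a p.1) (b p.2)].
Proof.
split; last first.
  move=> wrect; apply: lopen_local => p c /wrect[a [b [Za Xb abw cab]]].
  exists (mmap (a \o fst) (b \o snd)); split=> //.
  by case: (lopenP (lprod Z X)) => _ _; apply; apply: lowen_gen_sub;
    [left; exists a|right; exists b].
have [Zc _ Zm] := lopenP Z; have [Xc _ Xm] := lopenP X.
pose T : set (Z * X -> {i01 R}) := [set w | forall p c, c < w p ->
  exists a b, [/\ lopen Z a, lopen X b,
  forall q, Num.min (a q.1) (b q.2) <= w q & c < Num.min (a p.1) (b p.2)]].
suff : lopen (lprod Z X) `<=` T by apply.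
move=> {}w; apply; split; first split.
- move=> k p c ck; exists (cst k), (cst k).
  by split; [exact: Zc|exact: Xc|move=> q; rewrite minxx|rewrite minxx].
- move=> H HT p c /isup_gt[_ [f Hf <-] /(HT _ Hf)[a [b [Za Xb abf cab]]]].
  exists a, b; split=> // q; apply: le_trans (abf q) _.
  by apply: isup_ub; exists f.
- move=> f g Tf Tg p c; rewrite /mmap lt_min => /andP[].
  move=> /Tf[a [b [Za Xb abf cab]]] /Tg[a' [b' [Za' Xb' abg cab']]].
  exists (mmap a a'), (mmap b b'); split; [exact: Zm|exact: Xm| |].
    move=> q; rewrite /mmap minACA le_min.
    by rewrite !(ge_min _ (Num.min _ _)) abf abg orbT.
  by rewrite /mmap minACA lt_min cab.
- move=> _ [[a Za <-]|[b Xb <-]] p c /= cp.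
    exists a, (cst (a p.1)); split; rewrite ?minxx// => q.
    by rewrite ge_min lexx.
  exists (cst (b p.2)), b; split; rewrite ?minxx// => q.
  by rewrite ge_min lexx orbT.
Qed.

Lemma lcontinuous_SP Z (w : Z -> {i01 R}) :
  @lcontinuous R Z (lS R) w <-> lopen Z w.
Proof.
split=> [wcont|Zw]; last by apply: lcontinuous_gen => _ ->.
have /wcont : lopen (lS R) id by exact: lowen_gen_sub.
by [].
Qed.

Lemma lpow_lcontinuous Z Y n (A : 'I_n -> Z -> Y) :
  (forall i, lcontinuous (A i)) ->
  @lcontinuous R Z (lpow n Y) (fun z i => A i z).
Proof.
by move=> Acont; apply: lcontinuous_gen => _ [i [a [Ya ->]]]; exact: Acont.
Qed.

Lemma lslice_lcontinuous Z X (z : Z) :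
  @lcontinuous R X (lprod Z X) (fun x => (z, x)).
Proof.
apply: lcontinuous_gen => _ [[a _ <-]|[b Xb <-]] //.
exact: (fcst_subproof X (a z)).
Qed.

End LowenSpaces.

(** * Test spaces for Scott continuity *)

Section ProbeCharacterization.
Variables (R : realType) (X : lowen R).
Implicit Types (mu nu lam : fopen X) (D : set (fopen X)).
Implicit Types Phi : fopen X -> {i01 R}.

Lemma fjoin_ub D mu x : D mu -> mu x <= fjoin D x.
Proof.
by move=> Dmu; apply: isup_ub; exists (mu : X -> {i01 R}) => //; exists mu.
Qed.

Lemma fjoin_le D x c : (forall mu, D mu -> mu x <= c) -> fjoin D x <= c.
Proof. by move=> Dc; apply: isup_le => _ [_ [mu Dmu <-] <-]; exact: Dc. Qed.

Lemma fjoin_gt D x c : c < fjoin D x -> exists2 mu, D mu & c < mu x.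
Proof. by move=> /isup_gt[_ [_ [mu Dmu <-] <-]]; exists mu. Qed.

Lemma fle_anti mu nu : fle mu nu -> fle nu mu -> mu = nu.
Proof.
by move=> mn nm; apply: fopen_eq => x; apply/eqP; rewrite eq_le mn nm.
Qed.

Lemma fle_trans mu nu lam : fle mu nu -> fle nu lam -> fle mu lam.
Proof. by move=> mn nl x; apply: le_trans (nl x). Qed.

Definition jointly_open (Z : lowen R) (h : Z -> fopen X) : Prop :=
  lopen (lprod Z X) (fun p => h p.1 p.2).

(** The open maps of the test space that detects Scott continuity at [D].
    Asking for continuity along the single set [D] only, rather than along all
    directed sets, keeps the indicator of every upper set [{nu | mu <= nu}] with
    [mu] in [D] open. *)
Definition scott_along D : set (fopen X -> {i01 R}) :=
  [set w | (forall mu nu, fle mu nu -> w mu <= w nu) /\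
           forall c, c < w (fjoin D) -> exists2 mu, D mu & c < w mu].

(** Directedness is what makes [scott_along] closed under binary meets, as for
    the Scott topology. *)
Lemma scott_along_lowen D : fdirected D -> lowen_topology (scott_along D).
Proof.
move=> [[mu0 Dmu0] Ddir]; split.
- by move=> a; split=> // c ca; exists mu0.
- move=> H Hs; split=> [mu nu mn|c /isup_gt[_ [f Hf <-]]].
    apply: isup_le => _ [f Hf <-]; apply: le_trans ((Hs _ Hf).1 _ _ mn) _.
    by apply: isup_ub; exists f.
  move=> /(Hs _ Hf).2[mu Dmu cmu]; exists mu => //.
  by apply: lt_le_trans cmu _; apply: isup_ub; exists f.
- move=> f g [fmon fD] [gmon gD]; split=> [mu nu mn|c].
    by rewrite /mmap le_min !ge_min fmon//= gmon// orbT.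
  rewrite /mmap lt_min => /andP[/fD[mu Dmu cmu] /gD[nu Dnu cnu]].
  have [lam [Dlam ml nl]] := Ddir _ _ Dmu Dnu; exists lam => //.
  rewrite lt_min (lt_le_trans cmu (fmon _ _ ml)).
  exact: lt_le_trans cnu (gmon _ _ nl).
Qed.

(** A retraction onto the joins of subsets of [D]: it fixes the members of [D]
    and their join, and unlike the identity it is jointly open for
    [scott_along D]. *)
Definition fbelow D nu : fopen X := fjoin [set mu | D mu /\ fle mu nu].

Lemma fbelow_mem D nu : D nu -> fbelow D nu = nu.
Proof.
move=> Dnu; apply: fle_anti => x; first by apply: fjoin_le => mu [_ /(_ x)].
by apply: fjoin_ub; split=> // y; exact: lexx.
Qed.

Lemma fbelow_fjoin D : fbelow D (fjoin D) = fjoin D.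
Proof.
congr (fjoin _); rewrite predeqE => mu; split=> [[]//|Dmu].
by split=> // x; exact: fjoin_ub.
Qed.

Definition fup mu nu : {i01 R} :=
  if `[< fle mu nu >] then 1%:i01 else 0%:i01.

Lemma fupT mu nu : fle mu nu -> fup mu nu = 1%:i01.
Proof. by rewrite /fup => /asboolT ->. Qed.

Lemma fupF mu nu : ~ fle mu nu -> fup mu nu = 0%:i01.
Proof. by rewrite /fup => /asboolF ->. Qed.

(** [fbelow D nu x] is the supremum over [mu] in [D] of the rectangles
    [fup mu nu /\ mu x]. *)
Lemma fbelow_jointly_open D (dD : fdirected D) :
  @jointly_open (Lowen (scott_along_lowen dD)) (fbelow D).
Proof.
apply/lopen_prodP => -[nu x] c /fjoin_gt[mu [Dmu mn] cmu].
exists (fup mu), mu; split.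
- split=> [lam lam' ll'|c' _c].
    have [ml|nml] := pselect (fle mu lam); last by rewrite fupF// i01_ge0.
    by rewrite !fupT//; exact: fle_trans ll'.
  by exists mu => //; rewrite fupT// (lt_le_trans _c)// i01_le1.
- exact: fopenP.
- move=> [lam y] /=; have [ml|nml] := pselect (fle mu lam).
    by rewrite ge_min fjoin_ub ?orbT.
  by rewrite fupF// ge_min i01_ge0.
- by rewrite /= fupT// lt_min cmu (lt_le_trans cmu)// i01_le1.
Qed.

(** Testing against [fbelow D] gives continuity at the join of [D]; monotonicity
    is the case where [D] is a pair of comparable elements. *)
Lemma scott_continuous_probe Phi :
  (forall (Z : lowen R) (h : Z -> fopen X), jointly_open h ->
     lopen Z (Phi \o h)) ->
  scott_continuous Phi.
Proof.
move=> probe.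
have along D : fdirected D -> scott_along D (Phi \o fbelow D).
  move=> dD; exact: (probe _ _ (@fbelow_jointly_open _ dD)).
have mon mu nu : fle mu nu -> Phi mu <= Phi nu.
  move=> mn; have dD : fdirected [set mu; nu].
    split; first by exists mu; left.
    by move=> _ _ [->|->] [->|->]; exists nu; split=> //; right.
  have [/(_ mu nu mn) + _] := along _ dD.
  by rewrite /= !fbelow_mem//=; [right|left].
split=> // D dD; apply/eqP; rewrite eq_le; apply/andP; split; last first.
  by apply: isup_le => _ [mu Dmu <-]; apply: mon => x; exact: fjoin_ub.
rewrite leNgt; apply/negP => cD.
have [_ ] := along _ dD; rewrite /= fbelow_fjoin => /(_ _ cD)[mu Dmu].
rewrite fbelow_mem//; apply/negP; rewrite -leNgt.
by apply: isup_ub; exists mu.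
Qed.

(** * Finite combinations and the description of Sigma *)

(** The argument of [Phi] in the condition FTC. *)
Definition fcomb n (r : 'I_n -> {i01 R}) (beta : 'I_n -> fopen X) : fopen X :=
  fjoin [set fmeet (fcst X (r i)) (beta i) | i in [set: 'I_n]].

Lemma fcomb_ub n (r : 'I_n -> {i01 R}) (beta : 'I_n -> fopen X) i x :
  Num.min (r i) (beta i x) <= fcomb r beta x.
Proof.
by apply: (@fjoin_ub _ (fmeet (fcst X (r i)) (beta i))); exists i.
Qed.

Lemma fcomb_le n (r : 'I_n -> {i01 R}) (beta : 'I_n -> fopen X) x c :
  (forall i, Num.min (r i) (beta i x) <= c) -> fcomb r beta x <= c.
Proof. by move=> rc; apply: fjoin_le => _ [i _ <-]; exact: rc. Qed.

Lemma fcomb_jointly_open n (beta : 'I_n -> fopen X) :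
  @jointly_open (lpow n (lS R)) (fun r => fcomb r beta).
Proof.
apply/lopen_prodP => -[r x] c /fjoin_gt[_ [i _ <-] ci].
exists (fun r' => r' i), (beta i); split=> //.
- apply: lowen_gen_sub; exists i, id; split=> //; exact: lowen_gen_sub.
- exact: fopenP.
- by move=> [r' y]; exact: fcomb_ub.
Qed.

(** The combination of the [beta i] with open coefficients [A i] lies below [h]
    uniformly in [z], so that [Phi] of it is an open map below [Phi \o h]. *)
Definition inscribed (Z : lowen R) (h : Z -> fopen X) n
    (A : 'I_n -> Z -> {i01 R}) (beta : 'I_n -> fopen X) : Prop :=
  (forall i, lopen Z (A i)) /\ forall z, fle (fcomb (A^~ z) beta) (h z).

Definition glue T n m (f : 'I_n -> T) (g : 'I_m -> T) (i : 'I_(n + m)) : T :=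
  match fintype.split i with inl j => f j | inr k => g k end.

Lemma inscribed_glue (Z : lowen R) (h : Z -> fopen X) n m
    (A : 'I_n -> Z -> {i01 R}) (B : 'I_m -> Z -> {i01 R})
    (beta : 'I_n -> fopen X) (gam : 'I_m -> fopen X) :
  inscribed h A beta -> inscribed h B gam ->
  inscribed h (glue A B) (glue beta gam).
Proof.
move=> [oA sA] [oB sB]; split=> [i|z x].
  by rewrite /glue; case: fintype.split.
apply: fcomb_le => i; rewrite /glue; case: fintype.split => j.
  exact: le_trans (fcomb_ub (A^~ z) _ _ _) (sA z x).
exact: le_trans (fcomb_ub (B^~ z) _ _ _) (sB z x).
Qed.

Definition approximants (Z : lowen R) (h : Z -> fopen X) (z : Z) :
    set (fopen X) :=
  [set mu | exists n (A : 'I_n -> Z -> {i01 R}) (beta : 'I_n -> fopen X),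
    [/\ (0 < n)%N, inscribed h A beta & mu = fcomb (A^~ z) beta]].

(** Concatenating two inscribed combinations gives an inscribed combination
    above both. *)
Lemma approximants_directed (Z : lowen R) (h : Z -> fopen X) z :
  fdirected (approximants h z).
Proof.
split.
  eexists; exists 1%N, (fun=> cst 0%:i01), (fun=> fcst X 0%:i01); split=> //.
  split=> [i|z' x]; first exact: fcst_subproof.
  by apply: fcomb_le => i; rewrite ge_min i01_ge0.
move=> _ _ [n [A [beta [n0 iA ->]]]] [m [B [gam [m0 iB ->]]]].
exists (fcomb (fun i => glue A B i z) (glue beta gam)); split.
- exists (n + m)%N, (glue A B), (glue beta gam).
  by split=> //; [rewrite addn_gt0 n0|exact: inscribed_glue].
- move=> x; apply: fcomb_le => j.
  have := fcomb_ub (fun i => glue A B i z) (glue beta gam) (unsplit (inl j)) x.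
  by rewrite /glue unsplitK.
- move=> x; apply: fcomb_le => j.
  have := fcomb_ub (fun i => glue A B i z) (glue beta gam) (unsplit (inr j)) x.
  by rewrite /glue unsplitK.
Qed.

(** A single open rectangle below [h] is already an inscribed combination. *)
Lemma jointly_open_approximants (Z : lowen R) (h : Z -> fopen X) z :
  jointly_open h -> h z = fjoin (approximants h z).
Proof.
move=> /lopen_prodP hrect; apply: fle_anti => x; last first.
  by apply: fjoin_le => _ [n [A [beta [_ [_ sA] ->]]]]; exact: sA.
rewrite leNgt; apply/negP => /(hrect (z, x))[a [b [Za Xb abh]]] /=.
apply/negP; rewrite -leNgt.
apply: le_trans (@fcomb_ub 1 (fun=> a z) (fun=> FOpen Xb) ord0 x) _.
apply: fjoin_ub; exists 1%N, (fun=> a), (fun=> FOpen Xb); split=> //.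
by split=> // z' y; apply: fcomb_le => i; exact: (abh (z', y)).
Qed.

(** Scott continuity applies because [h z] is the directed join of its
    approximants; FTC, pulled back along the coefficients [Z -> lS R ^ n], then
    makes [Phi] of each approximant open in [z]. *)
Lemma Sigma_probe Phi (Z : lowen R) (h : Z -> fopen X) :
  Sigma Phi -> jointly_open h -> lopen Z (Phi \o h).
Proof.
move=> [[Phimon Phijoin] PhiFTC] ho.
apply: lopen_local => z c.
rewrite /= (jointly_open_approximants z ho) Phijoin; last first.
  exact: approximants_directed.
move=> /isup_gt[_ [_ [n [A [beta [n0 [oA sA] ->]]]] <-] cPhi].
exists (fun z => Phi (fcomb (A^~ z) beta)); split=> //; last first.
  by move=> z' /=; apply: Phimon; exact: sA.
have Acont : @lcontinuous R Z (lpow n (lS R)) (fun z i => A i z).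
  by apply: lpow_lcontinuous => i; apply/lcontinuous_SP.
exact: Acont (PhiFTC n beta n0).
Qed.

(** [Sigma] is the largest topology on the opens of [X] for which all jointly
    open families are continuous. *)
Lemma SigmaP Phi :
  Sigma Phi <->
  forall (Z : lowen R) (h : Z -> fopen X), jointly_open h -> lopen Z (Phi \o h).
Proof.
split=> [SPhi Z h|probe]; first exact: Sigma_probe.
split; first exact: scott_continuous_probe.
by move=> n beta _; exact: (probe _ _ (@fcomb_jointly_open _ beta)).
Qed.

(** An open rectangle [Phi(nu) /\ lam(y)] lies below [feval] exactly when
    [ltri lam Phi], so SKA at [mu] evaluated at [x] is the rectangle criterion
    for [feval] at [(mu, x)]. *)
Lemma feval_SKA : lcontinuous (@feval R X) <-> SKA X.
Proof.
split=> [/lcontinuous_SP/lopen_prodP erect mu|ska].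
  apply: fle_anti => x; last first.
    by apply: fjoin_le => _ [Phi [lam [_ tri ->]]]; exact: tri.
  rewrite leNgt; apply/negP => /(erect (mu, x))[Phi [b [SPhi Xb tri]]].
  apply/negP; rewrite -leNgt.
  apply: (@fjoin_ub _ (fmeet (fcst X (Phi mu)) (FOpen Xb))).
  by exists Phi, (FOpen Xb); split=> // nu y; exact: (tri (nu, y)).
apply/lcontinuous_SP/lopen_prodP => -[mu x] c; rewrite /feval /= {1}(ska mu).
move=> /fjoin_gt[_ [Phi [lam [SPhi tri ->]]] cx].
exists Phi, lam; split=> //; first exact: fopenP.
by move=> [nu y]; exact: tri.
Qed.

End ProbeCharacterization.

(** * The exponential adjunction *)

Section Exponential.
Variables (R : realType) (X : lowen R).
Implicit Types Y Z : lowen R.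

Definition lslice Z Y (H : lmap (lprod Z X) Y) (z : Z) : lmap X Y :=
  lcomp H (LMap (lslice_lcontinuous z)).

(** Pulling [v] back along the slices of [H] gives a jointly open family, whose
    composite with any [Phi] in [Sigma] is open by [Sigma_probe]. *)
Lemma lslice_lcontinuous_lexp Z Y (H : lmap (lprod Z X) Y) :
  @lcontinuous R Z (lexp X Y) (lslice H).
Proof.
apply: lcontinuous_gen => _ [[a _ <-]|[Phi [v [SPhi ->]]]].
  exact: (fcst_subproof Z a).
apply: (Sigma_probe SPhi (h := fun z => fpull v (lslice H z))).
have := lmapP H (fopenP v).
by congr (lopen (lprod Z X)); apply: funext => -[].
Qed.

Definition lcurry Z Y (H : lmap (lprod Z X) Y) : lmap Z (lexp X Y) :=
  LMap (lslice_lcontinuous_lexp H).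

(** The pullback of [v] is [(f, x) |-> feval (v \o f, x)], and a rectangle
    below [feval] with first side [Phi] pulls back to one with first side the
    generator [f |-> Phi (v \o f)]. *)
Lemma lapply_lcontinuous Y : SKA X ->
  @lcontinuous R (lprod (lexp X Y) X) Y (fun p => p.1 p.2).
Proof.
move=> /feval_SKA/lcontinuous_SP/lopen_prodP erect v Yv.
apply/lopen_prodP => -[f x] c /= cv.
have [Phi [b [SPhi Xb abe cab]]] := erect (fpull (FOpen Yv) f, x) c cv.
exists (fun g => Phi (fpull (FOpen Yv) g)), b; split=> //.
  by apply: lowen_gen_sub; right; exists Phi, (FOpen Yv).
by move=> [g y]; exact: (abe (fpull (FOpen Yv) g, y)).
Qed.

Definition luncurry (ska : SKA X) Z Y (k : lmap Z (lexp X Y)) :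
    lmap (lprod Z X) Y :=
  lcomp (LMap (@lapply_lcontinuous Y ska)) (fmap (prod_functor X) k).

Definition exp_adjunction (ska : SKA X) :
  adjunction (prod_functor X) (exp_functor X).
Proof.
refine (@Adjunction (LFTS R) (LFTS R) (prod_functor X) (exp_functor X)
  lcurry (luncurry ska) _ _ _ _).
- by move=> Z Y H; apply: lmap_eq => -[].
- by move=> Z Y k; apply: lmap_eq => z; apply: lmap_eq.
- by move=> Z Z' Y H f; apply: lmap_eq => z; apply: lmap_eq.
- by move=> Z Y Y' g H; apply: lmap_eq => z; apply: lmap_eq.
Defined.

End Exponential.

(** * Evaluation is continuous for an exponentiable space *)

Section ExponentiableEval.
Variables (R : realType) (X : lowen R) (G : cfunctor (LFTS R) (LFTS R)).
Variable adj : adjunction (prod_functor X) G.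

Lemma setT_lowen (T : Type) : lowen_topology [set: T -> {i01 R}].
Proof. by []. Qed.

(** On a one-point space every map to the unit interval is constant, so this is
    the terminal Lowen space. *)
Definition lpoint : lowen R := Lowen (@setT_lowen unit).

Let E : lowen R := G (lS R).
Let ev : lmap (lprod E X) (lS R) := counit adj (lS R).

Lemma counit_transposeE (Z Y : lowen R) (H : lmap (lprod Z X) Y) z x :
  (counit adj Y : lmap (lprod (G Y : lowen R) X) Y)
    ((transpose adj H : lmap Z (G Y : lowen R)) z, x) = H (z, x).
Proof. by rewrite -[in RHS](counit_transpose adj H). Qed.

(** Points of [E] are maps from the terminal space, which untransposing sends
    injectively to maps [lpoint * X -> lS R]. *)
Lemma counit_point_inj (p q : E) : (forall x, ev (p, x) = ev (q, x)) -> p = q.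
Proof.
move=> pq.
have kP (r : E) : @lcontinuous R lpoint E (fun=> r) by [].
suff : LMap (kP p) = LMap (kP q).
  by move=> /(congr1 (fun k : lmap lpoint E => k tt)).
apply: (can_inj (@untransposeK _ _ _ _ adj lpoint (lS R))).
rewrite !untransposeE; apply: lmap_eq => -[u x]; exact: pq.
Qed.

Lemma jointly_open_lcontinuous (Z : lowen R) (h : Z -> fopen X) :
  jointly_open h -> @lcontinuous R (lprod Z X) (lS R) (fun p => h p.1 p.2).
Proof. by move=> /lcontinuous_SP. Qed.

Lemma fopen_point_jointly_open (mu : fopen X) :
  @jointly_open R X lpoint (fun=> mu).
Proof. by apply: lowen_gen_sub; right; exists mu => //; exact: fopenP. Qed.

(** The element of [E] that names [mu]; together with [counit_point_inj] it
    identifies the underlying set of [E] with [fopen X]. *)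
Definition point_of (mu : fopen X) : E :=
  (transpose adj (LMap (jointly_open_lcontinuous (fopen_point_jointly_open mu)))
    : lmap lpoint E) tt.

Lemma counit_point_of mu x : ev (point_of mu, x) = mu x.
Proof. exact: counit_transposeE. Qed.

(** For jointly open [h], the map [point_of \o h] is the transpose of [h] read
    on [Z * X], hence continuous.  So each open [a] of [E] passes the tests of
    [SigmaP]. *)
Lemma point_of_lcontinuous : @lcontinuous R (Sigma_space X) E point_of.
Proof.
move=> a Ea; apply/SigmaP => Z h ho.
pose k : lmap Z E := transpose adj (LMap (jointly_open_lcontinuous ho)).
have <- : a \o k = a \o point_of \o h; last exact: lmapP.
apply: funext => z /=; congr a; apply: counit_point_inj => x.
by rewrite counit_point_of /k counit_transposeE.
Qed.

Lemma adjunction_feval : lcontinuous (@feval R X).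
Proof.
have -> : @feval R X = lcomp ev (fmap (prod_functor X)
    (LMap point_of_lcontinuous : cathom (Sigma_space X : LFTS R) E)).
  by apply: funext => -[mu x]; rewrite /= counit_point_of.
exact: lmapP.
Qed.

End ExponentiableEval.

Theorem theorem5p2 (R : realType) (X : lowen R) :
  (exponentiable X <-> lcontinuous (@feval R X)) /\
  (lcontinuous (@feval R X) <-> SKA X) /\
  (exponentiable X ->
    (exists adj : adjunction (prod_functor X) (exp_functor X),
       (forall (Z Y : lowen R) (H : lmap (lprod Z X) Y) (z : Z) (x : X),
          (transpose adj H : lmap Z (lexp X Y)) z x = H (z, x)) /\
       (forall (Y : lowen R) (f : lmap X Y) (x : X),
          (counit adj Y : lmap (lprod (lexp X Y) X) Y) (f, x) = f x)) /\
    (forall (G : cfunctor (LFTS R) (LFTS R))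
       (adj : adjunction (prod_functor X) G) (Y : lowen R),
       exists phi : lmap (G Y : lowen R) (lexp X Y),
         @is_iso (LFTS R) (G Y) (lexp X Y) phi /\
         forall (p : (G Y : lowen R)) (x : X),
           phi p x = (counit adj Y : lmap (lprod (G Y : lowen R) X) Y) (p, x))).
Proof.
have exp_ev : exponentiable X -> lcontinuous (@feval R X).
  by move=> [G [adj]]; exact: adjunction_feval adj.
split; first split=> // /feval_SKA ska.
  by exists (exp_functor X); split; exact: exp_adjunction.
split; first exact: feval_SKA.
move=> /exp_ev/feval_SKA ska; split; first by exists (exp_adjunction ska).
move=> G adj Y.
exists (transpose (exp_adjunction ska) (counit adj Y)); split=> //.
exact: (right_adjoint_iso adj (exp_adjunction ska)).
Qed.
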